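(* Let $d=d_1d_2\cdots d_n$ with integers $d_r\ge 2$, where $d_1=2$ or $d_1=3$, and $d_1\le d_r$ for $r=2,\ldots,n$. Then there exist at most $d_1+1$ pairwise mutually unbiased product bases in $\mathbb{C}^d=\mathbb{C}^{d_1}\otimes\cdots\otimes\mathbb{C}^{d_n}$.
   Context: A product basis of $\mathbb{C}^{d_1}\otimes\cdots\otimes\mathbb{C}^{d_n}$ is an orthonormal basis each of whose vectors is a tensor product $|\psi^1\rangle\otimes\cdots\otimes|\psi^n\rangle$ with $|\psi^r\rangle\in\mathbb{C}^{d_r}$. It need not be a tensor product of bases of the factors. Two orthonormal bases $\{|a_i\rangle\}$, $\{|b_j\rangle\}$ of $\mathbb{C}^d$ are mutually unbiased if $|\langle a_i|b_j\rangle|^2=1/d$ for all $i,j=1,\ldots,d$. *)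

(* Defs.v *)
From mathcomp Require Import all_boot all_order all_algebra.

Set Implicit Arguments.
Unset Strict Implicit.
Unset Printing Implicit Defensive.

Import Order.TTheory GRing.Theory Num.Theory.

Local Open Scope ring_scope.

(* C^I for a finite index set I, given by coordinates in the standard basis;
   C^o rather than C makes it a vectType over C. *)
Notation ket C I := {ffun I -> C^o}.

Definition braket (C : numClosedFieldType) (I : finType) (u v : ket C I) : C :=
  \sum_(x : I) (u x : C)^* * v x.

(* basis_of fullv forces D to be the dimension of ket C I. *)
Definition orthonormal_basis (C : numClosedFieldType) (I : finType) (D : nat)
    (b : D.-tuple (ket C I)) : Prop :=
  basis_of fullv b /\
  forall i j : 'I_D, braket (tnth b i) (tnth b j) = (i == j)%:R.

Definition mutually_unbiased (C : numClosedFieldType) (I : finType) (D : nat)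
    (a b : D.-tuple (ket C I)) : Prop :=
  forall i j : 'I_D, `|braket (tnth a i) (tnth b j)| ^+ 2 = (D%:R)^-1.

(* Multi-indices (i_1, ..., i_n) with i_r < d_r: they label the standard basis
   of C^(d_1) (x) ... (x) C^(d_n), so that ket C (multi_index d) is this tensor
   product, with the inner product determined by
   <u_1 (x) ... (x) u_n | v_1 (x) ... (x) v_n> = \prod_r <u_r | v_r>. *)
Definition multi_index (n : nat) (d : 'I_n -> nat) : finType :=
  {dffun forall r : 'I_n, 'I_(d r)}.

Definition tensor (C : numClosedFieldType) (n : nat) (d : 'I_n -> nat)
    (psi : forall r : 'I_n, ket C 'I_(d r)) : ket C (multi_index d) :=
  [ffun x : multi_index d => \prod_(r < n) (psi r (x r) : C)].

Definition product_basis (C : numClosedFieldType) (n : nat) (d : 'I_n -> nat)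
    (D : nat) (b : D.-tuple (ket C (multi_index d))) : Prop :=
  orthonormal_basis b /\
  forall i : 'I_D, exists psi : forall r : 'I_n, ket C 'I_(d r),
    tnth b i = tensor psi.

Fact dim_tensor_space (C : numClosedFieldType) (n : nat) (d : 'I_n -> nat) :
  \dim (@fullv C (ket C (multi_index d))) = (\prod_(r < n) d r)%N.
Proof.
rewrite dimvf /dim /= muln1 card_dep_ffun foldrE big_map -big_enum /=.
by apply: eq_bigr => r _; rewrite card_ord.
Qed.

Fact braket_tensor (C : numClosedFieldType) (n : nat) (d : 'I_n -> nat)
    (u v : forall r : 'I_n, ket C 'I_(d r)) :
  braket (tensor u) (tensor v) = \prod_(r < n) braket (u r) (v r).
Proof.
pose P r := [ffun y : 'I_(d r) => (u r y : C)^* * v r y].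
transitivity (\sum_(t : fprod (fun r => 'I_(d r))) \prod_(r < n) P r (t r)).
  rewrite /braket (reindex (@dffun_of_fprod _ (fun r => 'I_(d r)))) /=; last first.
    exact/onW_bij/dffun_of_fprod_bij.
  apply: eq_bigr => t _; rewrite !ffunE rmorph_prod -big_split /=.
  by apply: eq_bigr => r _; rewrite !ffunE.
rewrite big_fprod; apply/esym.
transitivity (\prod_(r < n) \sum_(g in tagged_with (fun r => 'I_(d r)) r)
  untag 0 (P r) g); last by rewrite bigA_distr_big_dep.
apply: eq_bigr => r _.
rewrite -(@big_tag _ _ _ _ (fun r => 'I_(d r)) (fun r => P r)).
by apply: eq_bigr => y _; rewrite ffunE.
Qed.

(* Main.v *)
Require Import Defs.
From mathcomp Require Import all_boot all_order all_algebra.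
From mathcomp Require Import complex reals.
From mathcomp Require Import ring zify.

(* If a product state is unbiased to a product basis, then each of its factors
   is unbiased to all the corresponding factors of the basis: Parseval fixes the
   averages of the factorwise overlaps, and AM-GM is then an equality. The first
   factors of the k bases are thus k mutually unbiased families of unit vectors
   in C^(d_1). The traceless parts of the projectors of distinct families are
   orthogonal, in a space of dimension d_1^2 - 1. A family contributes at least
   one dimension, which suffices when d_1 = 2, and at least two when d_1 >= 3,
   since it contains two vectors that are not parallel; hence k <= 3 when
   d_1 = 2, and 2 k <= 8 when d_1 = 3. *)

Set Implicit Arguments.
Unset Strict Implicit.
Unset Printing Implicit Defensive.

Import Order.TTheory GRing.Theory Num.Theory.

Local Open Scope ring_scope.

(** * Inner product and Parseval's identity *)

Section Braket.
Variables (C : numClosedFieldType) (I : finType).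
Implicit Types u v w : ket C I.

Lemma braket_sumr (J : finType) u (a : J -> C) (F : J -> ket C I) :
  braket u (\sum_j a j *: F j) = \sum_j a j * braket u (F j).
Proof.
under [RHS]eq_bigr do rewrite mulr_sumr.
rewrite exchange_big /=; apply: eq_bigr => x _.
rewrite sum_ffunE mulr_sumr; apply: eq_bigr => j _.
by rewrite ffunE mulrCA.
Qed.

Lemma braketZr a u v : braket u (a *: v) = a * braket u v.
Proof. by rewrite mulr_sumr; apply: eq_bigr => x _; rewrite ffunE mulrCA. Qed.

Lemma braketC u v : braket v u = (braket u v)^*.
Proof.
rewrite rmorph_sum; apply: eq_bigr => x _.
by rewrite rmorphM /= conjCK mulrC.
Qed.

Lemma braketZl a u v : braket (a *: u) v = a^* * braket u v.
Proof. by rewrite braketC braketZr rmorphM /= -braketC. Qed.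

Lemma braket_ge0 u : 0 <= braket u u.
Proof. by apply: sumr_ge0 => x _; rewrite mulrC mul_conjC_ge0. Qed.

Lemma braket_delta x u : braket [ffun y => (y == x)%:R] u = u x.
Proof.
rewrite /braket (bigD1 x) //= ffunE eqxx conjC1 mul1r big1 ?addr0 // => y ne_yx.
by rewrite ffunE (negPf ne_yx) conjC0 mul0r.
Qed.

Lemma parseval D (b : D.-tuple (ket C I)) v :
  orthonormal_basis b ->
  \sum_(i < D) `|braket v (tnth b i)| ^+ 2 = braket v v.
Proof.
case=> b_basis b_on; have := coord_basis b_basis (memvf v).
set c := fun i => coord b i v; rewrite -/c => v_sum.
have {}v_sum : v = \sum_i c i *: tnth b i.
  by rewrite [LHS]v_sum; apply: eq_bigr => i _; rewrite (tnth_nth 0).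
have c_braket i : braket (tnth b i) v = c i.
  rewrite v_sum braket_sumr (bigD1 i) //= b_on eqxx mulr1.
  rewrite big1 ?addr0 // => j ne_ji.
  by rewrite b_on eq_sym (negPf ne_ji) mulr0.
rewrite {3}v_sum braket_sumr.
apply: eq_bigr => i _.
by rewrite normCK -braketC c_braket mulrC.
Qed.

End Braket.

(** * Normalized factors of product vectors *)

Section UnitFactors.
Variables (C : numClosedFieldType) (n : nat) (d : 'I_n -> nat).

(** The norms of the factors multiply to 1, so dividing each factor by its norm leaves the tensor
    unchanged. *)
Lemma tensor_unit_factors (psi : forall r, ket C 'I_(d r)) :
  braket (tensor psi) (tensor psi) = 1 ->
  exists2 phi : forall r, ket C 'I_(d r),
    tensor psi = tensor phi & forall r, braket (phi r) (phi r) = 1.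
Proof.
rewrite braket_tensor => prod1.
pose a r : C := sqrtC (braket (psi r) (psi r)).
have a_ge0 r : 0 <= a r by rewrite sqrtC_ge0 braket_ge0.
have a_neq0 r : a r != 0.
  rewrite sqrtC_eq0; apply/eqP => z; move: prod1.
  by rewrite (bigD1 r) //= z mul0r => /esym/eqP; rewrite oner_eq0.
have prod_a : \prod_r a r = 1.
  apply/eqP; rewrite -(@eqrXn2 _ 2) ?prodr_ge0 // expr1n -prodrXl.
  by rewrite -[X in _ == X]prod1; apply/eqP/eq_bigr => r _; rewrite sqrtCK.
exists (fun r => (a r)^-1 *: psi r) => [|r].
  apply/ffunP => x; rewrite !ffunE.
  under [RHS]eq_bigr do rewrite ffunE.
  by rewrite big_split /= prodfV prod_a invr1 mul1r.
rewrite braketZl braketZr (geC0_conj _) ?invr_ge0 // mulrA -expr2 exprVn sqrtCK.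
by rewrite mulVf // -sqrtC_eq0 a_neq0.
Qed.

(** Distributivity, read off from [braket_tensor] with all-ones vectors on the left. *)
Lemma sum_prod_multi_index (f : forall r, 'I_(d r) -> C) :
  \sum_(x : multi_index d) \prod_r f r (x r) = \prod_r \sum_y f r y.
Proof.
pose one r : ket C 'I_(d r) := [ffun=> 1].
pose f' r : ket C 'I_(d r) := finfun (f r).
transitivity (braket (tensor one) (tensor f')).
  apply: eq_bigr => x _; rewrite !ffunE.
  rewrite [X in X^* * _]big1 => [|r _]; last by rewrite ffunE.
  by rewrite conjC1 mul1r; apply: eq_bigr => r _; rewrite ffunE.
rewrite braket_tensor; apply: eq_bigr => r _; apply: eq_bigr => y _.
by rewrite !ffunE conjC1 mul1r.
Qed.

End UnitFactors.

(** * Factorwise overlaps of a product vector with a product basis *)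

Section ProductBasisOverlaps.
Variables (C : numClosedFieldType) (n : nat) (d : 'I_n -> nat) (D : nat).
Variable b : D.-tuple (ket C (multi_index d)).
Variable phi : forall (i : 'I_D) (r : 'I_n), ket C 'I_(d r).
Hypothesis b_on : orthonormal_basis b.
Hypothesis b_phi : forall i, tnth b i = tensor (phi i).
Hypothesis phi_unit : forall i r, braket (phi i r) (phi i r) = 1.
Variable psi : forall r, ket C 'I_(d r).
Hypothesis psi_unit : forall r, braket (psi r) (psi r) = 1.

(** Scaled by [d r] so that unbiasedness in factor [r] becomes the value 1. *)
Let overlap i r : C := (d r)%:R * `|braket (psi r) (phi i r)| ^+ 2.

(* Parseval for the product vectors with factors psi_r for r in S and standard
   basis vectors e_(x_r) for r outside S, summed over all x. *)
Lemma sum_prod_overlaps (S : pred 'I_n) :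
  \sum_i \prod_(r | S r) overlap i r = (\prod_r d r)%:R.
Proof.
pose v (x : multi_index d) r : ket C 'I_(d r) :=
  if S r then psi r else [ffun y => (y == x r)%:R].
have v_unit x r : braket (v x r) (v x r) = 1.
  by rewrite /v; case: ifP => // _; rewrite braket_delta ffunE eqxx.
pose f i r y : C :=
  `|if S r then braket (psi r) (phi i r) else phi i r y| ^+ 2.
(* For [r] in [S] the summand does not depend on [y], whence the factor [d r] in [overlap]; for the
   other [r] the sum is the squared norm of [phi i r]. *)
have sum_f i r : \sum_y f i r y = if S r then overlap i r else 1.
  rewrite /f; case: ifP => _.
    by rewrite sumr_const card_ord /overlap mulr_natl.
  by rewrite -(phi_unit i r); apply: eq_bigr => y _; rewrite normCK mulrC.
transitivity (\sum_i \sum_(x : multi_index d) \prod_r f i r (x r)).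
  apply: eq_bigr => i _; rewrite big_mkcond sum_prod_multi_index.
  by apply: eq_bigr => r _; rewrite sum_f.
rewrite exchange_big /=.
transitivity (\sum_(x : multi_index d) (1 : C)); last first.
  rewrite sumr_const card_dep_ffun foldrE big_map -big_enum /=.
  by congr _%:R; apply: eq_bigr => r _; rewrite card_ord.
apply: eq_bigr => x _.
transitivity (braket (tensor (v x)) (tensor (v x))); last first.
  by rewrite braket_tensor big1.
rewrite -(parseval _ b_on); apply: eq_bigr => i _.
rewrite b_phi braket_tensor normr_prod -prodrXl; apply: eq_bigr => r _.
by rewrite /f /v; case: ifP => // _; rewrite braket_delta.
Qed.

Hypothesis D_eq : D = (\prod_r d r)%N.
Hypothesis psi_unbiased :
  forall i, `|braket (tensor psi) (tnth b i)| ^+ 2 = D%:R^-1.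

(* With q the overlap in factor r and q' the product of the others, q q' = 1,
   while q and q' both average to 1; hence the nonnegative numbers q + q' - 2
   sum to 0, which forces q = 1. *)
Lemma factor_unbiased i r : `|braket (psi r) (phi i r)| ^+ 2 = (d r)%:R^-1.
Proof.
pose q j := overlap j r; pose q' j := \prod_(s | s != r) overlap j s.
have D_gt0 : (0 < D)%N by apply: leq_ltn_trans (ltn_ord i).
have overlap_ge0 j s : 0 <= overlap j s by rewrite mulr_ge0 ?exprn_ge0.
have qq' j : q j * q' j = 1.
  transitivity (\prod_s overlap j s); first by rewrite [RHS](bigD1 r).
  rewrite big_split /= -natr_prod -D_eq.
  rewrite prodrXl -normr_prod -braket_tensor -b_phi psi_unbiased.
  by rewrite mulfV // pnatr_eq0 -lt0n.
have q_gt0 j : 0 < q j.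
  rewrite lt0r overlap_ge0 andbT; apply/eqP => q0.
  by have /esym/eqP := qq' j; rewrite q0 mul0r oner_eq0.
(* As q q' = 1, the AM-GM defect q + q' - 2 equals (q - 1)^2 / q: it is nonnegative and vanishes
   only at q = 1. *)
have q_def j : q j * (q j + q' j - 2) = (q j - 1) ^+ 2.
  by rewrite mulrBr mulrDr qq'; ring.
have q_real j : q j - 1 \is Num.real by rewrite realB ?gtr0_real ?real1.
have defect_ge0 j : 0 <= q j + q' j - 2.
  by rewrite -(pmulr_rge0 _ (q_gt0 j)) q_def real_exprn_even_ge0.
have sum_defect : \sum_j (q j + q' j - 2) == 0.
  have sum_q : \sum_j q j = D%:R.
    rewrite [in RHS]D_eq -(sum_prod_overlaps (fun s => s == r)).
    by apply: eq_bigr => j _; rewrite big_pred1_eq.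
  have sum_q' : \sum_j q' j = D%:R.
    by rewrite [in RHS]D_eq -(sum_prod_overlaps (fun s => s != r)).
  rewrite !big_split /= sum_q sum_q' sumr_const card_ord -[_ *+ D]mulr_natr.
  by apply/eqP; ring.
have := q_def i; move: sum_defect.
rewrite psumr_eq0 => [/allP/(_ i)|//].
rewrite mem_index_enum => /(_ isT)/eqP ->.
rewrite mulr0 => /esym/eqP; rewrite sqrf_eq0 subr_eq0 => /eqP q1.
have d_neq0 : (d r)%:R != 0 :> C.
  apply/eqP => z; move: q1; rewrite /q /overlap z mul0r => /esym/eqP.
  by rewrite oner_eq0.
by apply: (mulfI d_neq0); rewrite mulfV.
Qed.

End ProductBasisOverlaps.

(** * Dimension count for mutually unbiased families of unit vectors *)

Section UnbiasedFamilies.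
Variable C : numClosedFieldType.

(** The matrix [W] with rows [w t] has more rows than columns, so its left kernel contains a nonzero
    row of coefficients. *)
Lemma linear_relation (T X : finType) (w : T -> ket C X) :
  (#|X| < #|T|)%N ->
  exists z : T -> C, (exists t, z t != 0) /\ \sum_t z t *: w t = 0.
Proof.
move=> ltXT.
pose W := \matrix_(i < #|T|, j < #|X|) (w (enum_val i) (enum_val j) : C).
have: kermx W != 0.
  rewrite kermx_eq0 /row_free eqn_leq rank_leq_row -ltnNge.
  by rewrite (leq_ltn_trans (rank_leq_col W)).
case/rowV0Pn => z /sub_kermxP zW /rV0Pn [i zi].
exists (fun t => z 0 (enum_rank t)); split.
  by exists (enum_val i); rewrite enum_valK.
apply/ffunP => x; rewrite sum_ffunE ffunE.
transitivity ((z *m W) 0 (enum_rank x)); last by rewrite zW mxE.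
rewrite mxE.
rewrite [RHS](reindex _ (onW_bij _ (@enum_rank_bij T))) /=.
by apply: eq_bigr => t _; rewrite !mxE ffunE !enum_rankK.
Qed.

(** The operator |u><u| by its matrix entries; on [ket C (I * I)], [braket] is the Hilbert-Schmidt
    inner product. *)
Definition outer (I : finType) (u : ket C I) : ket C (I * I) :=
  [ffun xy => u xy.1 * (u xy.2)^*].

Definition identity_ket (I : finType) : ket C (I * I) :=
  [ffun xy => (xy.1 == xy.2)%:R].

Lemma braket_pair (I J : finType) (u v : ket C (I * J)) :
  braket u v = \sum_x \sum_y (u (x, y) : C)^* * v (x, y).
Proof. by rewrite pair_big; apply: eq_bigr => -[]. Qed.

Lemma braket_outer (I : finType) (u v : ket C I) :
  braket (outer u) (outer v) = `|braket u v| ^+ 2.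
Proof.
rewrite normCK -braketC /braket mulr_suml.
under [RHS]eq_bigr do rewrite mulr_sumr.
rewrite pair_big /=; apply: eq_bigr => -[x y] _ /=.
rewrite !ffunE /= rmorphM /= conjCK.
by rewrite mulrACA [X in _ * X]mulrC.
Qed.

(** Pairing with the identity is the trace. *)
Lemma braket_identity_outer (I : finType) (u : ket C I) :
  braket (identity_ket I) (outer u) = braket u u.
Proof.
rewrite braket_pair.
apply: eq_bigr => x _; rewrite (bigD1 x) //= !ffunE /= eqxx conjC1 mul1r.
rewrite big1 ?addr0 1?mulrC // => y ne_yx.
by rewrite !ffunE /= eq_sym (negPf ne_yx) conjC0 mul0r.
Qed.

Lemma braket_identity (I : finType) :
  braket (identity_ket I) (identity_ket I) = #|I|%:R.
Proof.
rewrite braket_pair -sum1_card natr_sum.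
apply: eq_bigr => x _; rewrite (bigD1 x) //= !ffunE /= eqxx conjC1 mul1r.
rewrite big1 ?addr0 // => y ne_yx.
by rewrite !ffunE /= eq_sym (negPf ne_yx) mulr0.
Qed.

(* The identity and the projectors onto the u s j are linearly independent
   operators on C^I: their traceless parts are orthogonal for distinct s, and
   gram_inj says that they are independent for each s. *)
Lemma unbiased_families_bound (I : finType) (k m : nat)
    (u : 'I_k -> 'I_m -> ket C I) :
  (0 < #|I|)%N ->
  (forall s j, braket (u s j) (u s j) = 1) ->
  (forall s t i j, s != t -> `|braket (u s i) (u t j)| ^+ 2 = #|I|%:R^-1) ->
  (forall s (z : 'I_m -> C),
     (forall i,
        \sum_j z j * (`|braket (u s i) (u s j)| ^+ 2 - #|I|%:R^-1) = 0) ->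
     forall j, z j = 0) ->
  (k * m < #|I| ^ 2)%N.
Proof.
move=> I_gt0 u_unit u_unbiased gram_inj; rewrite ltnNge; apply/negP => le_km.
(* With the identity as [None] these are k m + 1 operators, more than the dimension of the operator
   space if the bound fails. *)
pose w (t : option ('I_k * 'I_m)) : ket C (I * I) :=
  if t is Some (s, j) then outer (u s j) else identity_ket I.
have [|z [[t zt] zw]] := @linear_relation _ _ w.
  by rewrite card_option !card_prod !card_ord ltnS mulnn.
have rel a : \sum_t z t * braket a (w t) = 0.
  rewrite -braket_sumr zw /braket big1 // => x _.
  by rewrite ffunE mulr0.
have card_neq0 : #|I|%:R != 0 :> C by rewrite pnatr_eq0 -lt0n.
pose y s j := z (Some (s, j)).
have sum_option (F : option ('I_k * 'I_m) -> C) :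
    \sum_t F t = F None + \sum_s \sum_j F (Some (s, j)).
  rewrite (bigD1 None) //=; congr (_ + _).
  rewrite pair_big /= (reindex_omap Some id) //=; last by case.
  by apply: eq_big => [[s j]|[s j] _] //=; rewrite eqxx.
(* The trace of the relation expresses the coefficient of the identity through the others. *)
have trace_rel : z None * #|I|%:R + \sum_s \sum_j y s j = 0.
  apply: etrans (rel (identity_ket I)); rewrite sum_option /= braket_identity.
  congr (_ + _); apply: eq_bigr => s _; apply: eq_bigr => j _.
  by rewrite braket_identity_outer u_unit mulr1.
have zNone : z None = - (\sum_s \sum_j y s j * #|I|%:R^-1).
  have /eqP := trace_rel; rewrite addr_eq0 => /eqP trace_z.
  apply: (mulIf card_neq0); rewrite trace_z mulNr; congr (- _).
  rewrite mulr_suml; apply: eq_bigr => s _.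
  by rewrite mulr_suml; apply: eq_bigr => j _; rewrite mulfVK.
(* Pair the relation with the projector onto [u s i]: substituting [zNone] subtracts [#|I|%:R^-1]
   from every overlap, so the families other than [s] cancel and the premise of [gram_inj]
   remains. *)
have y0 s j : y s j = 0.
  apply: (gram_inj s (y s)) => i; rewrite -[RHS](rel (outer (u s i))).
  rewrite sum_option /= braketC braket_identity_outer u_unit conjC1 mulr1 zNone.
  rewrite addrC -sumrB [RHS](bigD1 s) //= [X in _ + X]big1 => [|t' ne_t's].
    rewrite addr0 -sumrB; apply: eq_bigr => l _.
    by rewrite braket_outer mulrBr.
  rewrite -sumrB big1 // => l _.
  by rewrite braket_outer u_unbiased 1?eq_sym // subrr.
case: t zt => [[s j]|]; first by rewrite -/(y s j) y0 eqxx.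
rewrite zNone big1 ?oppr0 ?eqxx // => s _.
by rewrite big1 // => j _; rewrite y0 mul0r.
Qed.

End UnbiasedFamilies.

(** * Two independent projectors from one family *)

Lemma product_basis_factor_nonconstant (C : numClosedFieldType) (n : nat)
    (d : 'I_n -> nat) (D : nat) (b : D.-tuple (ket C (multi_index d)))
    (phi : forall (i : 'I_D) (r : 'I_n), ket C 'I_(d r)) (r : 'I_n) (i : 'I_D) :
  orthonormal_basis b ->
  (forall i, tnth b i = tensor (phi i)) ->
  (forall i r, braket (phi i r) (phi i r) = 1) ->
  D = (\prod_r d r)%N -> d r != 1%N ->
  exists j, `|braket (phi i r) (phi j r)| ^+ 2 != 1.
Proof.
move=> b_on b_phi phi_unit D_eq d_neq1; apply/existsP; apply: contraNT d_neq1.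
rewrite negb_exists => /forallP all1.
(* By Parseval the overlaps of [phi i] in factor [r] sum to [D]; if all squared moduli were 1, they
   would sum to [D * d r]. *)
have := sum_prod_overlaps b_on b_phi phi_unit (phi_unit i) (fun s => s == r).
have D_gt0 : (0 < D)%N by apply: leq_ltn_trans (ltn_ord i).
rewrite -D_eq.
under eq_bigr => j _.
  rewrite big_pred1_eq (eqP (negbNE (all1 j))) mulr1; over.
rewrite sumr_const card_ord -mulrnA => /eqP.
by rewrite eqr_nat -[X in _ == X]mul1n eqn_pmul2r.
Qed.

(** In dimension 3 the traceless parts of two projectors have a Gram matrix with diagonal 1 - 1/3
    and off-diagonal entry c - 1/3. Its determinant (1 - c)(c + 1/3) is nonzero, as c is nonnegative
    and not 1. *)
Lemma unit_pair_gram_inj (C : numClosedFieldType) (I : finType)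
    (u : 'I_2 -> ket C I) :
  (forall j, braket (u j) (u j) = 1) ->
  `|braket (u ord0) (u ord_max)| ^+ 2 != 1 ->
  forall z : 'I_2 -> C,
    (forall i, \sum_j z j * (`|braket (u i) (u j)| ^+ 2 - 3%:R^-1) = 0) ->
    forall j, z j = 0.
Proof.
move=> u_unit.
have : 0 <= `|braket (u ord0) (u ord_max)| ^+ 2 by rewrite exprn_ge0.
have : `|braket (u ord_max) (u ord0)| = `|braket (u ord0) (u ord_max)|.
  by rewrite braketC norm_conjC.
set c := _ ^+ 2 => c_sym c_ge0 c_neq1 z z_rel.
have := z_rel ord0; have := z_rel ord_max.
rewrite !big_ord_recl !big_ord0 !addr0 /=.
have -> : lift ord0 ord0 = ord_max :> 'I_2 by apply: val_inj.
rewrite !u_unit c_sym -/c normr1 expr1n => rel1 rel0.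
have det_neq0 : (1 - c) * (c + 3%:R^-1) != 0.
  apply: mulf_neq0; first by rewrite subr_eq0 eq_sym.
  by rewrite lt0r_neq0 // ltr_wpDl // invr_gt0 ltr0n.
have z0 : z ord0 = 0.
  apply: (mulfI det_neq0); rewrite mulr0.
  (* Cramer's rule: the adjugate of the Gram matrix combines the two relations. *)
  have -> : (1 - c) * (c + 3%:R^-1) * z ord0
    = (1 - 3%:R^-1) * (z ord0 * (1 - 3%:R^-1) + z ord_max * (c - 3%:R^-1))
      - (c - 3%:R^-1) * (z ord0 * (c - 3%:R^-1) + z ord_max * (1 - 3%:R^-1)).
    by field.
  by rewrite rel0 rel1; ring.
have z1 : z ord_max = 0.
  apply: (mulfI det_neq0); rewrite mulr0.
  have -> : (1 - c) * (c + 3%:R^-1) * z ord_max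
    = (1 - 3%:R^-1) * (z ord0 * (c - 3%:R^-1) + z ord_max * (1 - 3%:R^-1))
      - (c - 3%:R^-1) * (z ord0 * (1 - 3%:R^-1) + z ord_max * (c - 3%:R^-1)).
    by field.
  by rewrite rel0 rel1; ring.
move=> j; have [/eqP|/eqP] : (val j == 0%N) \/ (val j == 1%N).
- by case: j => -[|[|]] //=; [left|right].
- by move=> e; rewrite -z0; congr z; apply: val_inj.
- by move=> e; rewrite -z1; congr z; apply: val_inj.
Qed.

(** * The bound for mutually unbiased product bases *)

Local Open Scope complex_scope.

Theorem theorem2 (R : realType) (n : nat) (d : 'I_n.+1 -> nat)
    (d_ge2 : forall r : 'I_n.+1, (2 <= d r)%N)
    (d1_small : d ord0 = 2%N \/ d ord0 = 3%N)
    (d1_min : forall r : 'I_n.+1, (d ord0 <= d r)%N)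
    (k : nat)
    (B : 'I_k -> (\prod_(r < n.+1) d r)%N.-tuple (ket R[i] (multi_index d)))
    (B_product : forall s : 'I_k, product_basis (B s))
    (B_unbiased : forall s t : 'I_k, s != t -> mutually_unbiased (B s) (B t)) :
  (k <= (d ord0).+1)%N.

Proof.
have exists_factors (s : 'I_k) (i : 'I_(\prod_(r < n.+1) d r)) :
    exists phi : forall r : 'I_n.+1, ket R[i] 'I_(d r),
      tnth (B s) i = tensor phi /\ forall r, braket (phi r) (phi r) = 1.
  have [[_ B_on] /(_ i)[psi psiE]] := B_product s.
  have [|phi E phi_unit] := @tensor_unit_factors _ _ _ psi.
    by rewrite -psiE B_on eqxx.
  by exists phi; rewrite psiE.
have /fin_all_exists [phi phiP] s := fin_all_exists (exists_factors s).
have B_on s : orthonormal_basis (B s) by case: (B_product s).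
have B_phi s i : tnth (B s) i = tensor (phi s i) by case: (phiP s i).
have phi_unit s i r : braket (phi s i r) (phi s i r) = 1 by case: (phiP s i).
have unbiased s t i j : s != t ->
    `|braket (phi s i ord0) (phi t j ord0)| ^+ 2 = (d ord0)%:R^-1.
  move=> ne_st; apply: (factor_unbiased (B_on t) (B_phi t)) => // l.
  by rewrite -B_phi B_unbiased.
have D_gt0 : (0 < \prod_(r < n.+1) d r)%N.
  by rewrite prodn_gt0 // => r; apply: leq_trans (d_ge2 r).
pose i0 := Ordinal D_gt0.
case: d1_small => d1; rewrite d1.
  (* One vector per basis: k < 4. *)
  suff : (k * 1 < #|'I_(d ord0)| ^ 2)%N by rewrite card_ord d1; lia.
  apply: (@unbiased_families_bound _ _ k 1 (fun s _ => phi s i0 ord0));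
    rewrite ?card_ord.
  - by rewrite d1.
  - by move=> s _; apply: phi_unit.
  - by move=> s t _ _; apply: unbiased.
  - move=> s z /(_ ord0); rewrite big_ord1 phi_unit normr1 expr1n d1 => /eqP.
    have half : 1 - 2%:R^-1 != 0 :> R[i].
      by rewrite subr_eq0 eq_sym invr_eq1 (eqr_nat _ 2 1).
    by rewrite mulf_eq0 (negPf half) orbF => /eqP z0 j; rewrite ord1.
have /fin_all_exists [j0 j0P] s :
    exists j, `|braket (phi s i0 ord0) (phi s j ord0)| ^+ 2 != 1.
  have d_neq1 : d ord0 != 1%N by rewrite d1.
  exact: (product_basis_factor_nonconstant i0 (B_on s) (B_phi s) (phi_unit s)).
pose u s (l : 'I_2) := phi s (if l == ord0 then i0 else j0 s) ord0.
(* Two non-parallel vectors per basis: 2 k < 9, so k is at most 4. *)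
suff : (k * 2 < #|'I_(d ord0)| ^ 2)%N by rewrite card_ord d1; lia.
apply: (@unbiased_families_bound _ _ k 2 u); rewrite ?card_ord.
- by rewrite d1.
- by move=> s l; apply: phi_unit.
- by move=> s t l l'; apply: unbiased.
- have -> : (d ord0)%:R = 3%:R :> R[i] by rewrite d1.
  move=> s; apply: unit_pair_gram_inj; last exact: j0P.
  by move=> l; apply: phi_unit.
Qed.
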